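(* Let $F(z)=\sum_{n=0}^{\infty}c_nz^n$ be analytic on the unit disc $\mathbb{D}$ with real coefficients $c_n$. Let $U(z)=\Re e\,F(z)$ and suppose $U$ has $L^{1}_{loc}$-boundary behavior on $\partial\mathbb{D}\setminus\{1\}$. Assume there is $\theta_0\in(0,\pi)$ such that one of the following holds: (b.1) there is $c\geq0$ such that $U(re^{i\theta})\geq -c$ for $\theta\in(-\theta_0,\theta_0)$ and $r\in[0,1)$; (b.2) $\sup_{0<r<1}\int_{-\theta_0}^{\theta_0}|U(re^{i\theta})|\,\mathrm{d}\theta<\infty$; (b.3) there are $g\in L^{1}(-\theta_0,\theta_0)$ and $k\in\mathbb{N}$ such that $U(re^{i\theta})=O((1-r)^{-k})$ for $\theta\in(-\theta_0,\theta_0)$, $r\in[0,1)$, and $U(re^{i\theta})\geq g(\theta)$ for a.e. $\theta\in(-\theta_0,\theta_0)$ and all $r\in[0,1)$. Then the sequence $\{c_n\}_{n=0}^\infty$ converges, and $\lim_{n\to\infty}c_n=\lim_{r\to1^{-}}(1-r)U(r)$.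
   Context: $U$ has $L^{1}_{loc}$-boundary behavior on $\partial\mathbb{D}\setminus\{1\}$ means: there is $f\in L^{1}_{loc}(0,2\pi)$ such that for every compact interval $J\subset(0,2\pi)$, $\lim_{r\to1^{-}}\int_J|U(re^{i\theta})-f(\theta)|\,\mathrm{d}\theta=0$. *)

(* Defs.v *)
From HB Require Import structures.
From mathcomp Require Import all_boot all_order all_algebra.
From mathcomp Require Import all_classical all_reals all_analysis.
Set Implicit Arguments. Unset Strict Implicit. Unset Printing Implicit Defensive.
Import Order.TTheory GRing.Theory Num.Theory.
Import numFieldNormedType.Exports.
Local Open Scope classical_set_scope.
Local Open Scope ring_scope.

(* A power series F(z) = sum c_n z^n with real coefficients c is analytic on
   the unit disc, i.e. it converges at every z = r e^{i theta}, 0 <= r < 1.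
   Convergence in C is expressed componentwise: the real parts
   c_n r^n cos(n theta) and imaginary parts c_n r^n sin(n theta) of
   c_n z^n = c_n r^n e^{i n theta} both form convergent series. *)
Definition analytic_on_disc (R : realType) (c : nat -> R) : Prop :=
  forall r theta : R, 0 <= r < 1 ->
    cvgn (series (fun n => c n * r ^+ n * cos (n%:R * theta))) /\
    cvgn (series (fun n => c n * r ^+ n * sin (n%:R * theta))).

Definition ReF (R : realType) (c : nat -> R) (r theta : R) : R :=
  limn (series (fun n => c n * r ^+ n * cos (n%:R * theta))).

(* L^1_loc boundary behaviour on the circle minus {1}, parametrised by
   theta in (0, 2 pi). *)
Definition L1loc_boundary (R : realType) (U : R -> R -> R) : Prop :=
  exists f : R -> R,
    (forall a b : R, 0 < a -> b < 2 * pi ->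
       (lebesgue_measure).-integrable `[a, b] (EFin \o f)) /\
    (forall a b : R, 0 < a -> b < 2 * pi ->
       (fun r => (\int[lebesgue_measure]_(t in `[a, b]) `|U r t - f t|%:E)%E)
         @ 1^'- --> 0%E).

(* Main.v *)
(* Everything takes place on [0, pi], since U_r = U(r e^{i theta}) is even.
   Each alternative bounds the integral of |U_r| over [0, pi] uniformly in r
   near 1: under a lower bound g one has |U_r| - U_r <= 2|g|, and the integral
   of U_r over [0, pi] is pi c_0.  Hence the boundary function f is integrable
   up to 0, and
     (pi / 2) (c_n r^n - c_m r^m) = int_0^pi U_r (cos n t - cos m t) dt
   is estimated on three pieces [0, d'], [d', d], [d, pi] as r -> 1.  On the
   first the cosine difference is small and the mass of U_r is bounded; on the
   second U_r is L^1-close to f, which has little mass there; on the third U_r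
   is L^1-close to a fixed U_rho, a uniform limit of trigonometric polynomials,
   for which the Riemann-Lebesgue property follows from orthogonality.  So c is
   Cauchy, and its limit is that of (1 - r) U(r) by Abel's theorem. *)

Require Import Defs.
From HB Require Import structures.
From mathcomp Require Import all_boot all_order all_algebra.
From mathcomp Require Import all_classical all_reals all_analysis.
From mathcomp Require Import measurable_realfun ring lra.
Import Order.TTheory GRing.Theory Num.Theory.
Import numFieldNormedType.Exports.
Local Open Scope classical_set_scope.
Local Open Scope ring_scope.

Set Implicit Arguments.
Unset Strict Implicit.

Local Notation mu := lebesgue_measure.

(** * Integrals of cosines *)

Lemma integrable_itv_bounded (R : realType) (f : R -> R) (M a b : R) :
  measurable_fun setT f -> (forall x, `|f x| <= M) ->
  mu.-integrable `[a, b] (EFin \o f).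
Proof.
move=> mf fM; apply: measurable_bounded_integrable => //.
- by rewrite /= lebesgue_measure_itv /=; case: ifP => // _; rewrite -EFinB ltry.
- exact: measurable_funTS.
- exists M; split=> [|x Mx y _]; first exact: num_real.
  exact: le_trans (fM y) (ltW Mx).
Qed.

Lemma norm_Rintegral_le d (T : measurableType d) (R : realType)
    (m : {measure set T -> \bar R}) (D : set T) (f h : T -> R) :
  measurable D -> m.-integrable D (EFin \o f) -> m.-integrable D (EFin \o h) ->
  (forall x, D x -> `|f x| <= h x) ->
  `|\int[m]_(x in D) f x| <= \int[m]_(x in D) h x.
Proof.
move=> mD fi hi fh; apply: le_trans (le_normr_Rintegral mD fi) _.
by apply: le_Rintegral => //; exact: integrable_norm.
Qed.

Lemma integrable_itvS (R : realType) (f : R -> R) (a b a' b' : R) :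
  a <= a' -> b' <= b ->
  mu.-integrable `[a, b] (EFin \o f) -> mu.-integrable `[a', b'] (EFin \o f).
Proof.
move=> aa bb; apply: integrableS => //= x /=; rewrite !in_itv/= => /andP[ax xb].
by rewrite (le_trans aa ax) (le_trans xb bb).
Qed.

Lemma Rintegral_itv_split (R : realType) (f : R -> R) (a b c : R) :
  a <= b -> b <= c -> mu.-integrable `[a, c] (EFin \o f) ->
  \int[mu]_(t in `[a, c]) f t =
  \int[mu]_(t in `[a, b]) f t + \int[mu]_(t in `[b, c]) f t.
Proof.
move=> ab bc fi; rewrite -(@Rintegral_itv_obnd_cbnd _ b).
  by rewrite -(@Rintegral_itvB _ f (BLeft a) (BRight c) b)// 1?addrC ?subrK// bnd_simp.
apply: integrableS fi => //= x /=; rewrite !in_itv/= => /andP[bx ->].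
by rewrite (le_trans ab (ltW bx)).
Qed.

Lemma continuous_cosM (R : realType) (k : R) : continuous (fun t : R => cos (k * t)).
Proof.
move=> x; apply: (@continuous_comp _ _ _ (fun t : R => k * t) cos).
  by apply: continuousM; [exact: cvg_cst|exact: cvg_id].
exact: continuous_cos.
Qed.

Lemma measurable_cosM (R : realType) (k : R) :
  measurable_fun setT (fun t : R => cos (k * t)).
Proof. apply: continuous_measurable_fun; exact: continuous_cosM. Qed.

Lemma Rintegral_cosM (R : realType) (k a b : R) : 0 < k -> a < b ->
  \int[mu]_(t in `[a, b]) cos (k * t) = (sin (k * b) - sin (k * a)) / k.
Proof.
move=> k0 ab; rewrite /Rintegral.
have dF (x : R) : is_derive x 1 (fun t : R => sin (k * t) / k) (cos (k * x)).
  apply: (@is_derive_eq _ _ _ (fun t : R => sin (k * t) / k)).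
  by rewrite /GRing.scale/= mulr0 add0r mulr1 mulrCA mulVf ?mulr1// gt_eqF.
rewrite (@continuous_FTC2 _ _ (fun t : R => sin (k * t) / k))//=.
- by rewrite -mulrBl.
- by apply: continuous_subspaceT; exact: continuous_cosM.
- have cF : continuous (fun t : R => sin (k * t) / k).
    by move=> x; apply/differentiable_continuous/derivable1_diffP.
  split; first by move=> x _; exact: ex_derive.
  + by apply: cvg_at_right_filter; exact: cF.
  + by apply: cvg_at_left_filter; exact: cF.
- by move=> x _; rewrite derive1E derive_val.
Qed.

Lemma integrable_mulrl d (T : measurableType d) (R : realType)
    (m : {measure set T -> \bar R}) (D : set T) (f : T -> R) (k : R) :
  measurable D -> m.-integrable D (EFin \o f) ->
  m.-integrable D (EFin \o (fun x => k * f x)).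
Proof.
move=> mD fi; have := integrableZl mD k fi; apply: eq_integrable => // x _ /=.
Qed.

Lemma integrable_cosM (R : realType) (k a b : R) :
  mu.-integrable `[a, b] (EFin \o (fun t : R => cos (k * t))).
Proof.
by apply: (@integrable_itv_bounded _ _ 1); [exact: measurable_cosM|move=> x; exact: cos_max].
Qed.

Lemma cosMcosM (R : realType) (k n : nat) (t : R) : (n <= k)%N ->
  cos (k%:R * t) * cos (n%:R * t) =
  2^-1 * cos ((k - n)%:R * t) + 2^-1 * cos ((k + n)%:R * t).
Proof.
by move=> nk; rewrite natrB// natrD mulrBl mulrDl cosB cosD; field.
Qed.

Lemma Rintegral_cosMcosM (R : realType) (k n : nat) (a b : R) : (n <= k)%N ->
  \int[mu]_(t in `[a, b]) (cos (k%:R * t) * cos (n%:R * t)) =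
  2^-1 * \int[mu]_(t in `[a, b]) cos ((k - n)%:R * t) +
  2^-1 * \int[mu]_(t in `[a, b]) cos ((k + n)%:R * t).
Proof.
move=> nk; under eq_Rintegral do rewrite cosMcosM//.
rewrite RintegralD//=; first last.
- by apply: integrable_mulrl => //; exact: integrable_cosM.
- by apply: integrable_mulrl => //; exact: integrable_cosM.
by rewrite !RintegralZl//; exact: integrable_cosM.
Qed.

Lemma norm_Rintegral_cosM (R : realType) (k a b : R) : 0 < k -> a < b ->
  `|\int[mu]_(t in `[a, b]) cos (k * t)| <= 2 / k.
Proof.
move=> k0 ab; rewrite Rintegral_cosM// normrM normfV (gtr0_norm k0).
rewrite ler_pM2r ?invr_gt0// (le_trans (ler_normB _ _))//.
by have := sin_max (k * b); have := sin_max (k * a); lra.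
Qed.

Lemma norm_Rintegral_cosMcosM (R : realType) (k n : nat) (a b : R) :
  (k < n)%N -> a < b ->
  `|\int[mu]_(t in `[a, b]) (cos (k%:R * t) * cos (n%:R * t))| <= 2 / (n - k)%:R.
Proof.
move=> kn ab; under eq_Rintegral do rewrite mulrC.
rewrite Rintegral_cosMcosM 1?ltnW//.
have nk0 : 0 < (n - k)%:R :> R by rewrite ltr0n subn_gt0.
have h1 := norm_Rintegral_cosM nk0 ab.
have npk : (n - k)%:R <= (n + k)%:R :> R.
  by rewrite ler_nat (leq_trans (leq_subr _ _))// leq_addr.
have h2 := norm_Rintegral_cosM (lt_le_trans nk0 npk) ab.
have h3 : 2 / (n + k)%:R <= 2 / (n - k)%:R :> R.
  by rewrite ler_pM2l// lef_pV2// posrE (lt_le_trans nk0).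
rewrite (le_trans (ler_normD _ _))// !normrM [`|2^-1|]gtr0_norm ?invr_gt0//.
by move: h1 h2 h3; lra.
Qed.

Lemma Rintegral_cosMn_pi (R : realType) (k : nat) :
  \int[mu]_(t in `[0, pi]) cos (k%:R * t) = if k is 0%N then pi else 0 :> R.
Proof.
case: k => [|k].
  under eq_Rintegral do rewrite mul0r cos0.
  by rewrite Rintegral_cst//= lebesgue_measure_itv /= lte_fin pi_gt0 -EFinB/= subr0 mul1r.
rewrite Rintegral_cosM ?pi_gt0//.
suff -> : sin (k.+1%:R * pi) = 0 :> R by rewrite mulr0 sin0 subrr mul0r.
elim: k.+1 => [|m IH]; first by rewrite mul0r sin0.
by rewrite -natr1 mulrDl mul1r sinDpi IH oppr0.
Qed.

Lemma Rintegral_cosMcosM_pi (R : realType) (k n : nat) :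
  \int[mu]_(t in `[0, pi]) (cos (k%:R * t) * cos (n%:R * t)) =
  if k == n then (if n is 0%N then pi else pi / 2) else 0 :> R.
Proof.
(* By symmetry the truncated difference [k - n] may be taken to be the true one. *)
wlog nk : k n / (n <= k)%N.
  move=> h; have [nk|kn] := leqP n k; first exact: h.
  under eq_Rintegral do rewrite mulrC.
  by rewrite h 1?ltnW// eq_sym; case: eqVneq => // ->.
rewrite Rintegral_cosMcosM// !Rintegral_cosMn_pi.
case: eqVneq => [->|kn].
  by rewrite subnn; case: n {nk} => [|n]; rewrite ?addn0/=; field.
have : (0 < k - n)%N by rewrite subn_gt0 ltn_neqAle eq_sym kn nk.
case: (k - n)%N => // j _; case: k nk kn => [|k nk kn]; first
  by rewrite leqn0 => /eqP -> /eqP.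
by rewrite !mulr0 addr0.
Qed.

(** * Fourier coefficients of U_r *)

(** At angle 0 and a radius [s] strictly between [r] and 1 the terms [c n * s ^+ n] tend to 0, hence
    are bounded. Comparison with a geometric series of ratio [r / s] follows. *)
Lemma summable_coef (R : realType) (c : nat -> R) (r : R) :
  analytic_on_disc c -> 0 <= r < 1 ->
  cvgn (series (fun n => `|c n| * r ^+ n)).
Proof.
move=> ac /andP[r0 r1]; pose s := (1 + r) / 2.
have [rs s1] : r < s /\ s < 1 by rewrite /s; split; lra.
have s0 : 0 < s by exact: le_lt_trans rs.
have s01 : 0 <= s < 1 by rewrite (ltW s0).
have [/cvg_series_cvg_0 /cvgP /cvg_seq_bounded[K0 [_ K0b]] _] := ac s 0 s01.
(* Boundedness is available only for constants strictly above [K0]. *)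
pose K := K0 + 1; have Kb := K0b K (ltr_pwDr ltr01 (lexx K0)).
have {}Kb n : `|c n| * s ^+ n <= K.
  have := Kb n I; rewrite /= mulr0 cos0 mulr1 normrM normrX (gtr0_norm s0).
  exact.
have Kge0 : 0 <= K 
  by exact: le_trans (mulr_ge0 (normr_ge0 _) (exprn_ge0 _ (ltW s0))) (Kb 0%N).
apply: (@series_le_cvg _ _ (geometric K (r / s))).
- by move=> n; rewrite mulr_ge0// exprn_ge0.
- by move=> n; rewrite /= mulr_ge0// exprn_ge0// divr_ge0// ltW.
- move=> n; rewrite /= expr_div_n mulrCA mulrC ler_wpM2l ?exprn_ge0//.
  by rewrite ler_pdivlMr ?exprn_gt0.
- apply: is_cvg_geometric_series; rewrite (ger0_norm (divr_ge0 r0 (ltW s0))).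
  by rewrite ltr_pdivrMr// mul1r.
Qed.

Definition cos_sum (R : realType) (c : nat -> R) (r : R) (N : nat) (t : R) : R :=
  series (fun n => c n * r ^+ n * cos (n%:R * t)) N.

Lemma cvg_cos_sum (R : realType) (c : nat -> R) (r t : R) :
  analytic_on_disc c -> 0 <= r < 1 -> cos_sum c r N t @[N --> \oo] --> ReF c r t.
Proof. by move=> ac r01; have [] := ac r t r01. Qed.

Lemma norm_cos_sumB (R : realType) (c : nat -> R) (r t : R) (N P : nat) :
  0 <= r -> (N <= P)%N ->
  `|cos_sum c r P t - cos_sum c r N t| <=
  series (fun n => `|c n| * r ^+ n) P - series (fun n => `|c n| * r ^+ n) N.
Proof.
move=> r0 NP; rewrite /cos_sum !sub_series_geq//.
apply: le_trans (ler_norm_sum _ _ _) _; apply: ler_sum => k _.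
rewrite !normrM (ger0_norm (exprn_ge0 _ r0)) -[leRHS]mulr1.
by rewrite ler_wpM2l ?cos_max// mulr_ge0 ?exprn_ge0.
Qed.

Lemma cos_sum0 (R : realType) (c : nat -> R) (r t : R) : cos_sum c r 0 t = 0.
Proof. by rewrite /cos_sum /series/= big_geq. Qed.

Lemma norm_cos_sum (R : realType) (c : nat -> R) (r t : R) (N : nat) :
  0 <= r -> `|cos_sum c r N t| <= series (fun n => `|c n| * r ^+ n) N.
Proof.
move=> r0; have := norm_cos_sumB c t r0 (leq0n N).
by rewrite cos_sum0 [X in _ <= _ - X]/series/= big_geq// !subr0.
Qed.

Lemma nondecreasing_abs_series (R : realType) (c : nat -> R) (r : R) :
  0 <= r -> nondecreasing_seq (series (fun n => `|c n| * r ^+ n)).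
Proof. by move=> r0; apply: nondecreasing_series => n _ _; rewrite mulr_ge0 ?exprn_ge0. Qed.

(** Weierstrass M-test: the tail is dominated by that of the series of [|c n| * r ^+ n], so [N] is
    chosen before [t]. *)
Lemma ReF_tail (R : realType) (c : nat -> R) (r e : R) :
  analytic_on_disc c -> 0 <= r < 1 -> 0 < e ->
  \forall N \near \oo, forall t, `|ReF c r t - cos_sum c r N t| <= e.
Proof.
move=> ac r01 e0; have r0 : 0 <= r by case/andP: r01.
have /cvgrPdist_le/(_ _ e0) sb := summable_coef ac r01.
near=> N => t.
have h : `|cos_sum c r P t - cos_sum c r N t| @[P --> \oo] -->
    `|ReF c r t - cos_sum c r N t|.
  by apply: cvg_norm; apply: cvgB; [exact: cvg_cos_sum|exact: cvg_cst].
apply: (cvgr_to_le h).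
near=> P; apply: le_trans (norm_cos_sumB c t r0 _) _; first by
  near: P; exact: nbhs_infty_ge.
apply: (le_trans (y := limn (series (fun n => `|c n| * r ^+ n)) -
    series (fun n => `|c n| * r ^+ n) N)).
  by rewrite lerD2r; apply: nondecreasing_cvgn_le;
    [exact: nondecreasing_abs_series|exact: summable_coef].
by apply: le_trans (ler_norm _) _; near: N.
Unshelve. all: by end_near. Qed.

Lemma ReF_bounded (R : realType) (c : nat -> R) (r : R) :
  analytic_on_disc c -> 0 <= r < 1 -> exists M, forall t, `|ReF c r t| <= M.
Proof.
move=> ac r01; have r0 : 0 <= r by case/andP: r01.
exists (limn (series (fun n => `|c n| * r ^+ n))) => t.
have h : `|cos_sum c r P t| @[P --> \oo] --> `|ReF c r t|.
  by apply: cvg_norm; exact: cvg_cos_sum.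
apply: (cvgr_to_le h).
near=> P; apply: le_trans (norm_cos_sum c t P r0) _.
by apply: nondecreasing_cvgn_le; [exact: nondecreasing_abs_series|exact: summable_coef].
Unshelve. all: by end_near. Qed.

Lemma measurable_cos_sum (R : realType) (c : nat -> R) (r : R) (N : nat) :
  measurable_fun setT (cos_sum c r N).
Proof.
apply: measurable_sum => k.
by apply: measurable_funM => //; exact: measurable_cosM.
Qed.

Lemma measurable_ReF (R : realType) (c : nat -> R) (r : R) :
  analytic_on_disc c -> 0 <= r < 1 -> measurable_fun setT (ReF c r).
Proof.
move=> ac r01; apply: (@measurable_fun_cvg _ _ _ setT (cos_sum c r)).
  by move=> N; exact: measurable_cos_sum.
by move=> t _; exact: cvg_cos_sum.
Qed.

(** Allows [ReF c r] to be replaced by a trigonometric polynomial, at a cost that does not depend on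
    the frequency [k]. *)
Lemma Rintegral_cosM_close (R : realType) (u v : R -> R) (k a b e M M' : R) :
  a <= b -> 0 <= e -> measurable_fun setT u -> measurable_fun setT v ->
  (forall t, `|u t| <= M) -> (forall t, `|v t| <= M') ->
  (forall t, `|u t - v t| <= e) ->
  `|\int[mu]_(t in `[a, b]) (u t * cos (k * t)) -
    \int[mu]_(t in `[a, b]) (v t * cos (k * t))| <= e * (b - a).
Proof.
move=> ab e0 mmu mv uM vM uv.
have icos (w : R -> R) (K : R) : measurable_fun setT w -> (forall t, `|w t| <= K) ->
    mu.-integrable `[a, b] (EFin \o (fun t => w t * cos (k * t))).
  move=> mw wK; apply: (@integrable_itv_bounded _ _ K).
    by apply: measurable_funM => //; exact: measurable_cosM.
  move=> t; rewrite normrM -[leRHS]mulr1; apply: ler_pM => //; exact: cos_max.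
rewrite -RintegralB//; [|exact: (icos _ _ _ uM)|exact: (icos _ _ _ vM)].
under eq_Rintegral do rewrite -mulrBl.
apply: (le_trans (y := \int[mu]_(t in `[a, b]) (fun=> e) t)).
  apply: norm_Rintegral_le => //.
  - by apply: (icos (fun t => u t - v t) e _ uv); exact: measurable_funB.
  - by apply: (@integrable_itv_bounded _ _ e) => // t; rewrite ger0_norm.
  - move=> t _; rewrite normrM -[leRHS]mulr1; apply: ler_pM => //; exact: cos_max.
rewrite Rintegral_cst//= lebesgue_measure_itv /= lte_fin.
by case: ifP => [_|]; rewrite -?EFinB//= mulr0 mulr_ge0// subr_ge0.
Qed.

Lemma Rintegral_cos_sumM (R : realType) (c : nat -> R) (r a b : R) (N n : nat) :
  \int[mu]_(t in `[a, b]) (cos_sum c r N t * cos (n%:R * t)) =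
  \sum_(0 <= k < N)
     c k * r ^+ k * \int[mu]_(t in `[a, b]) (cos (k%:R * t) * cos (n%:R * t)).
Proof.
have icc k : mu.-integrable `[a, b] (EFin \o (fun t : R => cos (k%:R * t) * cos (n%:R * t))).
  apply: (@integrable_itv_bounded _ _ 1).
    by apply: measurable_funM => //; exact: measurable_cosM.
  by move=> t; rewrite normrM -[leRHS]mulr1; apply: ler_pM => //; exact: cos_max.
elim: N => [|N IH].
  rewrite big_geq//; under eq_Rintegral do rewrite cos_sum0 mul0r.
  by rewrite Rintegral_cst// mul0r.
rewrite big_nat_recr//= -IH -RintegralZl//.
transitivity (\int[mu]_(t in `[a, b]) (cos_sum c r N t * cos (n%:R * t) +
    c N * r ^+ N * (cos (N%:R * t) * cos (n%:R * t)))).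
  apply: eq_Rintegral => t _; rewrite /cos_sum /series/= big_nat_recr//=.
  by rewrite mulrDl -!mulrA.
rewrite RintegralD//; last exact: integrable_mulrl.
have r0N : exists K, forall t, `|cos_sum c r N t| <= K.
  exists (series (fun n => `|c n| * `|r| ^+ n) N) => t.
  apply: le_trans (ler_norm_sum _ _ _) _; apply: ler_sum => k _.
  by rewrite !normrM normrX -[leRHS]mulr1 ler_wpM2l ?cos_max// mulr_ge0 ?exprn_ge0.
have [K KP] := r0N; apply: (@integrable_itv_bounded _ _ K).
  by apply: measurable_funM; [exact: measurable_cos_sum|exact: measurable_cosM].
by move=> t; rewrite normrM -[leRHS]mulr1; apply: ler_pM => //; exact: cos_max.
Qed.

(** By orthogonality every partial sum with [N > n] already has this cosine coefficient. Uniform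
    convergence carries the identity to the limit, as the two sides differ by at most any
    [e > 0]. *)
Lemma ReF_coef (R : realType) (c : nat -> R) (r : R) (n : nat) :
  analytic_on_disc c -> 0 <= r < 1 ->
  \int[mu]_(t in `[0, pi]) (ReF c r t * cos (n%:R * t)) =
  (if n is 0%N then pi else pi / 2) * (c n * r ^+ n).
Proof.
move=> ac r01; have r0 : 0 <= r by case/andP: r01.
have pi0 : 0 < pi :> R by exact: pi_gt0.
have [M RM] := ReF_bounded ac r01.
apply/eqP; rewrite -subr_eq0 -normr_le0; apply/ler_addgt0Pr => e e0; rewrite add0r.
have e0' : 0 < e / pi by rewrite divr_gt0.
near \oo => N; have nN : (n < N)%N by near: N; exact: nbhs_infty_gt.
have -> : (if n is 0%N then pi else pi / 2) * (c n * r ^+ n) =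
    \int[mu]_(t in `[0, pi]) (cos_sum c r N t * cos (n%:R * t)).
  rewrite Rintegral_cos_sumM (eq_bigr (fun k => if k == n then
    (c k * r ^+ k) * (if n is 0%N then pi else pi / 2) else 0)); last first.
    by move=> k _; rewrite Rintegral_cosMcosM_pi; case: ifP => //; rewrite mulr0.
  by rewrite -big_mkcond big_nat1_eq nN mulrC.
apply: (le_trans (y := e / pi * (pi - 0))); last
  by rewrite subr0 mulrVK ?unitfE ?gt_eqF.
apply: (Rintegral_cosM_close n%:R (ltW pi0) (ltW e0') _ _ RM
  (fun t => norm_cos_sum c t N r0)).
- exact: measurable_ReF.
- exact: measurable_cos_sum.
- near: N; exact: (ReF_tail ac r01 e0').
Unshelve. all: by end_near. Qed.

(** Half of [e] pays for replacing [ReF c r] by a fixed partial sum of length [N]. The other half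
    bounds the integral of that sum, whose frequencies stay below [N] while [n] grows. *)
Lemma ReF_Riemann_Lebesgue (R : realType) (c : nat -> R) (r a b e : R) :
  analytic_on_disc c -> 0 <= r < 1 -> a < b -> 0 < e ->
  \forall n \near \oo, `|\int[mu]_(t in `[a, b]) (ReF c r t * cos (n%:R * t))| <= e.
Proof.
move=> ac r01 ab e0; have r0 : 0 <= r by case/andP: r01.
have [M RM] := ReF_bounded ac r01.
have ba0 : 0 < b - a by rewrite subr_gt0.
have e0' : 0 < e / 2 / (b - a) by rewrite !divr_gt0.
have [N] := filter_ex (ReF_tail ac r01 e0') => Nt.
pose D := \sum_(0 <= k < N) `|c k * r ^+ k|.
have D0 : 0 <= D by rewrite /D big_mkord sumr_ge0.
near=> n.
have := Rintegral_cosM_close n%:R (ltW ab) (ltW e0') (measurable_ReF ac r01)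
  (measurable_cos_sum c r N) RM (fun t => norm_cos_sum c t N r0) Nt.
rewrite mulrVK ?unitfE ?gt_eqF//.
set I := \int[mu]_(t in _) _; set J := \int[mu]_(t in _) _ => IJ.
suff : `|J| <= e / 2 by have := ler_normD (I - J) J; rewrite subrK; move: IJ; lra.
(* The term [4 * D / e] makes [D * (2 / (n - N))] at most [e / 2]; the added 1 forces [N < n] even
   when [D] is 0. *)
have nN : N%:R + (1 + 4 * D / e) <= n%:R :> R by near: n; exact: nbhs_infty_ger.
have De : 0 <= 4 * D / e by rewrite divr_ge0 ?mulr_ge0// ltW.
have Nn : (N < n)%N by rewrite -(ltr_nat R); move: nN De; lra.
have nN0 : 0 < (n - N)%:R :> R by rewrite ltr0n subn_gt0.
apply: (le_trans (y := D * (2 / (n - N)%:R))).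
  rewrite /J Rintegral_cos_sumM /D mulr_suml.
  apply: le_trans (ler_norm_sum _ _ _) _; apply: ler_sum_nat => k /andP[_ kN].
  rewrite normrM ler_wpM2l//.
  have kn : (k < n)%N by exact: ltn_trans Nn.
  apply: le_trans (norm_Rintegral_cosMcosM kn ab) _.
  rewrite ler_pM2l// lef_pV2 ?posrE// ?ltr0n ?subn_gt0//.
  by rewrite ler_nat leq_sub2l// ltnW.
rewrite mulrA ler_pdivrMr// natrB ?(ltnW Nn)//.
have : e / 2 * (4 * D / e) <= e / 2 * (n%:R - N%:R).
  by rewrite ler_wpM2l//; move: nN; lra.
have -> : e / 2 * (4 * D / e) = D * 2 by field; rewrite gt_eqF.
done.
Unshelve. all: by end_near. Qed.

(** A class closed under products and differences whose members are integrable on every bounded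
    interval; it settles the integrability side conditions below. *)
Definition bounded_measurable (R : realType) (w : R -> R) :=
  measurable_fun setT w /\ exists K, forall t, `|w t| <= K.

Lemma bounded_measurable_integrable (R : realType) (w : R -> R) (a b : R) :
  bounded_measurable w -> mu.-integrable `[a, b] (EFin \o w).
Proof. by move=> [mw [K wK]]; exact: integrable_itv_bounded wK. Qed.

Lemma bounded_measurableM (R : realType) (v w : R -> R) :
  bounded_measurable v -> bounded_measurable w ->
  bounded_measurable (fun t => v t * w t).
Proof.
move=> [mv [K vK]] [mw [L wL]]; split; first exact: measurable_funM.
by exists (K * L) => t; rewrite normrM; apply: ler_pM.
Qed.

Lemma bounded_measurableB (R : realType) (v w : R -> R) :
  bounded_measurable v -> bounded_measurable w ->
  bounded_measurable (fun t => v t - w t).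
Proof.
move=> [mv [K vK]] [mw [L wL]]; split; first exact: measurable_funB.
by exists (K + L) => t; apply: le_trans (ler_normB _ _) _; apply: lerD.
Qed.

Lemma bounded_measurable_norm (R : realType) (w : R -> R) :
  bounded_measurable w -> bounded_measurable (fun t => `|w t|).
Proof.
move=> [mw [L wL]]; split; first exact: measurableT_comp.
by exists L => t; rewrite normr_id.
Qed.

Lemma bounded_measurable_cst (R : realType) (k : R) :
  bounded_measurable (fun=> k).
Proof. by split => //; exists `|k|. Qed.

Lemma bounded_measurable_cos (R : realType) (k : R) :
  bounded_measurable (fun t => cos (k * t)).
Proof. by split; [exact: measurable_cosM|exists 1 => t; exact: cos_max]. Qed.

Lemma bounded_measurable_ReF (R : realType) (c : nat -> R) (r : R) :
  analytic_on_disc c -> 0 <= r < 1 -> bounded_measurable (ReF c r).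
Proof. by move=> ac r01; split; [exact: measurable_ReF|exact: ReF_bounded]. Qed.

Lemma ReF_coef0 (R : realType) (c : nat -> R) (r : R) :
  analytic_on_disc c -> 0 <= r < 1 ->
  \int[mu]_(t in `[0, pi]) ReF c r t = pi * c 0%N.
Proof.
move=> ac r01; have := ReF_coef 0 ac r01; rewrite expr0 mulr1 => <-.
by apply: eq_Rintegral => t _; rewrite mul0r cos0 mulr1.
Qed.

Lemma integrable_subr d (T : measurableType d) (R : realType)
    (m : {measure set T -> \bar R}) (D : set T) (f g : T -> R) :
  measurable D -> m.-integrable D (EFin \o f) -> m.-integrable D (EFin \o g) ->
  m.-integrable D (EFin \o (fun x => f x - g x)).
Proof. by move=> mD fi gi; have := integrableB mD fi gi; apply: eq_integrable. Qed.

Lemma integrable_addr d (T : measurableType d) (R : realType)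
    (m : {measure set T -> \bar R}) (D : set T) (f g : T -> R) :
  measurable D -> m.-integrable D (EFin \o f) -> m.-integrable D (EFin \o g) ->
  m.-integrable D (EFin \o (fun x => f x + g x)).
Proof. by move=> mD fi gi; have := integrableD mD fi gi; apply: eq_integrable. Qed.

(** * Convergence of the coefficients *)

Lemma near01 (R : realType) : \forall r \near 1^'-, 0 <= r < (1 : R).
Proof.
near=> r; apply/andP; split; near: r; [exact: nbhs_left_ge|exact: nbhs_left_lt].
Unshelve. all: by end_near. Qed.

Lemma Rintegral_norm_itv_le (R : realType) (h : R -> R) (a b a' b' : R) :
  a <= a' -> b' <= b ->
  mu.-integrable `[a, b] (EFin \o (fun t => `|h t|)) ->
  \int[mu]_(t in `[a', b']) `|h t| <= \int[mu]_(t in `[a, b]) `|h t|.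
Proof.
move=> aa bb hi.
have [ab|ba] := leP a' b'; last first.
  by rewrite set_itv_ge ?bnd_simp -?ltNge// Rintegral_set0 Rintegral_ge0.
rewrite (Rintegral_itv_split aa (le_trans ab bb) hi).
rewrite (Rintegral_itv_split ab bb); last exact: integrable_itvS aa (lexx b) hi.
have h1 : 0 <= \int[mu]_(t in `[a, a']) `|h t| by exact: Rintegral_ge0.
have h2 : 0 <= \int[mu]_(t in `[b', b]) `|h t| by exact: Rintegral_ge0.
by move: h1 h2; lra.
Qed.

Section CoefCvg.
Context (R : realType).

(** The error budget on bare variables, later instantiated with integrals: [4 * e] for the middle
    piece, [6 * e] for the outer one, [11 * e] in all. *)
Let lin1 (x y z e : R) : y <= e -> x <= y -> z <= e -> 2 * (x + z) <= 4 * e.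
Proof. lra. Qed.

Let lin2 (x y z w e : R) : x <= e -> y <= e -> z <= 4 * e -> w <= x + y ->
  z + w <= 6 * e.
Proof. lra. Qed.

Let lin3 (e : R) : e + (4 * e + 6 * e) <= 11 * e.
Proof. lra. Qed.

Context (c : nat -> R) (f : R -> R) (M : R)
  (ac : analytic_on_disc c)
  (fi : forall a : R, 0 < a -> mu.-integrable `[a, pi] (EFin \o f))
  (Uf : forall a : R, 0 < a ->
     \int[mu]_(t in `[a, pi]) `|ReF c r t - f t| @[r --> 1^'-] --> 0)
  (UM : \forall r \near 1^'-, \int[mu]_(t in `[0, pi]) `|ReF c r t| <= M).

Let near_dist (a e : R) : 0 < a -> 0 < e ->
  \forall r \near 1^'-, \int[mu]_(t in `[a, pi]) `|ReF c r t - f t| <= e.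
Proof.
move=> a0 e0; have /cvgrPdist_le/(_ _ e0) := Uf a0.
apply: filterS => r; rewrite sub0r normrN; exact: le_trans (ler_norm _).
Qed.

Let iU (a b r : R) : 0 <= r < 1 -> mu.-integrable `[a, b] (EFin \o ReF c r).
Proof. by move=> r01; apply/bounded_measurable_integrable/bounded_measurable_ReF. Qed.

Let inU (a b r : R) : 0 <= r < 1 ->
  mu.-integrable `[a, b] (EFin \o (fun t => `|ReF c r t|)).
Proof. by move=> r01; apply: integrable_norm; exact: iU. Qed.

Let inUf (a b r : R) : 0 < a -> b <= pi -> 0 <= r < 1 ->
  mu.-integrable `[a, b] (EFin \o (fun t => `|ReF c r t - f t|)).
Proof.
move=> a0 bpi r01; apply: integrable_norm; apply: integrable_subr => //; first exact: iU.
exact: integrable_itvS (lexx a) bpi (fi a0).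
Qed.

Let inf_ (a b : R) : 0 < a -> b <= pi ->
  mu.-integrable `[a, b] (EFin \o (fun t => `|f t|)).
Proof.
by move=> a0 bpi; apply: integrable_norm; exact: integrable_itvS (lexx a) bpi (fi a0).
Qed.

(** Integrate [|f| <= |U_r| + |U_r - f|] and let [r] tend to 1. The bound is uniform in [a], which
    expresses integrability of [f] up to 0. *)
Let fM (a : R) : 0 < a -> a < pi -> \int[mu]_(t in `[a, pi]) `|f t| <= M.
Proof.
move=> a0 api; apply/ler_addgt0Pr => e e0.
near (1 : R)^'- => r.
have r01 : 0 <= r < 1 by near: r; exact: near01.
have h1 : \int[mu]_(t in `[a, pi]) `|ReF c r t - f t| <= e.
  by near: r; exact: near_dist.
have h2 : \int[mu]_(t in `[0, pi]) `|ReF c r t| <= M by near: r.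
have h3 : \int[mu]_(t in `[a, pi]) `|ReF c r t| <= \int[mu]_(t in `[0, pi]) `|ReF c r t|.
  by apply: Rintegral_norm_itv_le; [exact: ltW|exact: lexx|exact: inU].
have h4 : \int[mu]_(t in `[a, pi]) `|f t| <=
    \int[mu]_(t in `[a, pi]) (`|ReF c r t| + `|ReF c r t - f t|).
  apply: le_Rintegral => //; first exact: inf_.
    by apply: integrable_addr => //; [exact: inU|exact: inUf].
  by move=> t _; have := ler_normB (ReF c r t) (ReF c r t - f t); rewrite subKr.
rewrite RintegralD//= in h4; [|exact: inU|exact: inUf].
by move: h1 h2 h3 h4; lra.
Unshelve. all: by end_near. Qed.

(** The integrals of [|f|] over [[a, pi]] are bounded by [M]. If [d] brings them within [e] of their
    supremum, extending the interval down to [d'] adds at most [e]. Uniformity in [d'] matters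
    because [d'] will depend on [n] and [m], whereas [d] must not. *)
Let tail_f (e : R) : 0 < e -> exists d, [/\ 0 < d, d < pi &
  forall d', 0 < d' -> d' <= d -> \int[mu]_(t in `[d', d]) `|f t| <= e].
Proof.
move=> e0; pose A := [set \int[mu]_(t in `[a, pi]) `|f t| | a in `]0, pi[].
have pi0 : 0 < pi :> R by exact: pi_gt0.
have supA : has_sup A.
  split.
    exists (\int[mu]_(t in `[pi / 2, pi]) `|f t|), (pi / 2) => //=.
    by rewrite in_itv/= divr_gt0//= ltr_pdivrMr// ltr_pMr// ltr1n.
  by exists M => _ [a /= + <-]; rewrite in_itv/= => /andP[a0 api]; exact: fM.
have [_ [d /= + <-] Ad] := sup_adherent e0 supA; rewrite in_itv/= => /andP[d0 dpi].
exists d; split=> // d' d'0 d'd.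
have := Rintegral_itv_split d'd (ltW dpi) (inf_ d'0 (lexx pi)).
have : \int[mu]_(t in `[d', pi]) `|f t| <= sup A.
  apply: (ub_le_sup (proj2 supA)).
  by exists d' => //=; rewrite in_itv/= d'0 (le_lt_trans d'd).
by move: Ad; lra.
Qed.

Let M0 : 0 <= M.
Proof.
near (1 : R)^'- => r.
by apply: (le_trans (y := \int[mu]_(t in `[0, pi]) `|ReF c r t|));
  [exact: Rintegral_ge0|near: r].
Unshelve. all: by end_near. Qed.

Let small_cosB (n m : nat) (e d : R) : 0 < e -> 0 < d -> exists d', [/\ 0 < d', d' <= d &
  forall t, 0 <= t <= d' -> `|cos (n%:R * t) - cos (m%:R * t)| <= e].
Proof.
move=> e0 d0.
have : (fun t : R => cos (n%:R * t) - cos (m%:R * t)) @ (0 : R) -->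
    cos (n%:R * 0) - cos (m%:R * 0).
  by apply: cvgB; exact: continuous_cosM.
rewrite !mulr0 subrr => /cvgrPdist_le/(_ _ e0)/nbhs_ballP[x /= x0 xP].
exists (Num.min d (x / 2)); split; first by rewrite lt_min d0 divr_gt0.
  by rewrite ge_min lexx.
move=> t /andP[t0]; rewrite le_min => /andP[_ tx].
have := xP t; rewrite sub0r normrN; apply.
rewrite /ball/= sub0r normrN ger0_norm// (le_lt_trans tx)//.
by rewrite ltr_pdivrMr// ltr_pMr// ltr1n.
Qed.

Let bm_cosB (n m : nat) :
  bounded_measurable (fun t : R => cos (n%:R * t) - cos (m%:R * t)).
Proof. by apply: bounded_measurableB; exact: bounded_measurable_cos. Qed.

Let cosB2 (n m : nat) (t : R) : `|cos (n%:R * t) - cos (m%:R * t)| <= 2.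
Proof.
apply: le_trans (ler_normB _ _) _.
by have := cos_max (n%:R * t); have := cos_max (m%:R * t); lra.
Qed.

(** Order of choices: [d] and [rho] are given, [d'] then depends on [n] and [m], and [r] tends to 1
    last. Positive indices ensure that both coefficients carry the factor [pi / 2]. *)
Let coef_dist (n m : nat) (e d rho : R) : 0 < e -> 0 < d < pi -> 0 <= rho < 1 ->
  (0 < n)%N -> (0 < m)%N ->
  (forall d', 0 < d' -> d' <= d -> \int[mu]_(t in `[d', d]) `|f t| <= e) ->
  \int[mu]_(t in `[d, pi]) `|ReF c rho t - f t| <= e ->
  `|\int[mu]_(t in `[d, pi]) (ReF c rho t * cos (n%:R * t))| <= e ->
  `|\int[mu]_(t in `[d, pi]) (ReF c rho t * cos (m%:R * t))| <= e ->
  pi / 2 * `|c n - c m| <= 11 * e.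
Proof.
move=> e0 /andP[d0 dpi] rho01 n0 m0 fd frho RLn RLm.
have pi0 : 0 < pi :> R by exact: pi_gt0.
(* Adding 1 keeps the denominator positive when [M] is 0. *)
have eM : 0 < e / (M + 1) by rewrite divr_gt0// ltr_wpDl.
have [d' [d'0 d'd cosd']] := small_cosB n m eM d0.
pose w t : R := cos (n%:R * t) - cos (m%:R * t).
have bw : bounded_measurable w by exact: bm_cosB.
(* The powers of [r] tend to 1, so a bound valid for all [r] near 1 passes to [c n - c m]. *)
have h : `|pi / 2 * (c n * r ^+ n - c m * r ^+ m)| @[r --> 1^'-] -->
    `|pi / 2 * (c n * 1 ^+ n - c m * 1 ^+ m)|.
  apply: cvg_norm; apply: cvgM; first exact: cvg_cst.
  by apply: cvgB; apply: cvgM; try exact: cvg_cst;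
    apply: cvg_at_left_filter; exact: exprn_continuous.
rewrite !expr1n !mulr1 normrM gtr0_norm ?divr_gt0// in h.
apply: (cvgr_to_le h); near=> r.
have r01 : 0 <= r < 1 by near: r; exact: near01.
have bU := bounded_measurable_ReF ac r01.
have bUw := bounded_measurableM bU bw.
have bV := bounded_measurable_ReF ac rho01.
have -> : pi / 2 * (c n * r ^+ n - c m * r ^+ m) =
    \int[mu]_(t in `[0, pi]) (ReF c r t * w t).
  under eq_Rintegral do rewrite mulrBr.
  rewrite RintegralB//=; try by
    apply/bounded_measurable_integrable/bounded_measurableM => //;
    exact: bounded_measurable_cos.
  by rewrite !ReF_coef// mulrBr; case: n m n0 m0 {RLn RLm h w bw bUw cosd'} => [//|n] [].
rewrite (@Rintegral_itv_split _ _ 0 d')//; [|exact: ltW|exact: le_trans d'd (ltW dpi)|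
  exact: bounded_measurable_integrable].
rewrite (@Rintegral_itv_split _ _ d' d)//; [|exact: ltW|exact: bounded_measurable_integrable].
have hM : \int[mu]_(t in `[0, pi]) `|ReF c r t| <= M by near: r.
have hd : \int[mu]_(t in `[d', pi]) `|ReF c r t - f t| <= e.
  by near: r; exact: near_dist.
(* Here [|w| <= e / (M + 1)], and the mass of [U_r] is at most [M]. *)
have I1 : `|\int[mu]_(t in `[0, d']) (ReF c r t * w t)| <= e.
  apply: (le_trans (y := \int[mu]_(t in `[0, d']) (e / (M + 1) * `|ReF c r t|))).
    apply: norm_Rintegral_le => //; first exact: bounded_measurable_integrable.
      by apply: integrable_mulrl => //; exact: inU.
    move=> t /=; rewrite in_itv/= => t0d; rewrite normrM mulrC ler_wpM2r//.
    exact: cosd'.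
  rewrite RintegralZl//; last exact: inU.
  apply: (le_trans (y := e / (M + 1) * M)).
    rewrite ler_wpM2l ?(ltW eM)//; apply: le_trans hM.
    apply: Rintegral_norm_itv_le => //; first exact: le_trans d'd (ltW dpi).
    exact: inU.
  by rewrite mulrAC ler_pdivrMr ?ltr_wpDl// ler_wpM2l ?(ltW e0)// lerDl.
(* Here [|w| <= 2] and [|U_r| <= |U_r - f| + |f|], each summand having integral at most [e]. *)
have I2 : `|\int[mu]_(t in `[d', d]) (ReF c r t * w t)| <= 4 * e.
  apply: (le_trans (y := \int[mu]_(t in `[d', d]) (2 * (`|ReF c r t - f t| + `|f t|)))).
    have dpi' := ltW dpi.
    apply: norm_Rintegral_le => //; first exact: bounded_measurable_integrable.
      apply: integrable_mulrl => //.
      by apply: integrable_addr => //; [exact: inUf|exact: inf_].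
    move=> t _; rewrite normrM mulrC; apply: ler_pM => //; first exact: cosB2.
    by have := ler_normD (ReF c r t - f t) (f t); rewrite subrK.
  have dpi' := ltW dpi.
  rewrite RintegralZl//; last first.
    by apply: integrable_addr => //; [exact: inUf|exact: inf_].
  rewrite RintegralD//=; [|exact: inUf|exact: inf_].
  have := fd d' d'0 d'd.
  have : \int[mu]_(t in `[d', d]) `|ReF c r t - f t| <=
      \int[mu]_(t in `[d', pi]) `|ReF c r t - f t|.
    by apply: Rintegral_norm_itv_le => //; exact: inUf.
  by move: hd; exact: lin1.
(* Both [U_r] and [U_rho] are within [e] of [f] in mean, so exchanging them against [|w| <= 2] costs
   [4 * e]; the oscillatory integrals of [U_rho] at [n] and [m] add [e] each. *)
have I3 : `|\int[mu]_(t in `[d, pi]) (ReF c r t * w t)| <= 6 * e.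
  have -> : \int[mu]_(t in `[d, pi]) (ReF c r t * w t) =
      \int[mu]_(t in `[d, pi]) ((ReF c r t - ReF c rho t) * w t) +
      (\int[mu]_(t in `[d, pi]) (ReF c rho t * cos (n%:R * t)) -
       \int[mu]_(t in `[d, pi]) (ReF c rho t * cos (m%:R * t))).
    rewrite -RintegralB//; try by
      apply/bounded_measurable_integrable/bounded_measurableM => //;
      exact: bounded_measurable_cos.
    rewrite -RintegralD//; first last.
    - apply: bounded_measurable_integrable; apply: bounded_measurableB;
        apply/bounded_measurableM => //; exact: bounded_measurable_cos.
    - apply/bounded_measurable_integrable/bounded_measurableM => //.
      exact: bounded_measurableB.
    by apply: eq_Rintegral => t _; rewrite -mulrBr -mulrDl subrK.
  have : `|\int[mu]_(t in `[d, pi]) ((ReF c r t - ReF c rho t) * w t)| <= 4 * e.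
    apply: (le_trans (y := \int[mu]_(t in `[d, pi])
        (2 * (`|ReF c r t - f t| + `|ReF c rho t - f t|)))).
      apply: norm_Rintegral_le => //.
      - apply/bounded_measurable_integrable/bounded_measurableM => //.
        exact: bounded_measurableB.
      - apply: integrable_mulrl => //.
        by apply: integrable_addr => //; exact: inUf.
      move=> t _; rewrite normrM mulrC; apply: ler_pM => //; first exact: cosB2.
      have := ler_normB (ReF c r t - f t) (ReF c rho t - f t).
      by rewrite opprB addrA subrK.
    rewrite RintegralZl//; last by apply: integrable_addr => //; exact: inUf.
    rewrite RintegralD//=; try exact: inUf.
    have : \int[mu]_(t in `[d, pi]) `|ReF c r t - f t| <=
        \int[mu]_(t in `[d', pi]) `|ReF c r t - f t|.
      by apply: Rintegral_norm_itv_le => //; exact: inUf.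
    by move=> h'; exact: (lin1 hd h' frho).
  move=> h3; apply: le_trans (ler_normD _ _) _.
  have := ler_normB (\int[mu]_(t in `[d, pi]) (ReF c rho t * cos (n%:R * t)))
    (\int[mu]_(t in `[d, pi]) (ReF c rho t * cos (m%:R * t))).
  exact: (lin2 RLn RLm h3).
apply: le_trans (ler_normD _ _) _.
apply: le_trans (lerD I1 (le_trans (ler_normD _ _) (lerD I2 I3))) _.
exact: lin3.
Unshelve. all: by end_near. Qed.

Lemma coef_cvg : cvgn c.
Proof.
apply/cauchy_cvgP; apply: cauchy_exP => e e0.
have pi0 : 0 < pi :> R by exact: pi_gt0.
(* Since [12 * x] is [pi / 2 * e], the bound [11 * x] yields a strict inequality after cancelling
   [pi / 2]. *)
pose x := e * pi / 2 / 12.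
have x0 : 0 < x by rewrite !divr_gt0// mulr_gt0.
have [d [d0 dpi fd]] := tail_f x0.
near (1 : R)^'- => rho.
have rho01 : 0 <= rho < 1 by near: rho; exact: near01.
have frho : \int[mu]_(t in `[d, pi]) `|ReF c rho t - f t| <= x.
  by near: rho; exact: near_dist.
have [N _ NP] := ReF_Riemann_Lebesgue ac rho01 dpi x0.
(* The successor guarantees a positive index. *)
exists (c N.+1); exists N.+1 => // n /= Nn.
rewrite /ball/=; have := @coef_dist N.+1 n x d rho.
rewrite d0 dpi => /(_ x0 isT rho01 isT (leq_ltn_trans (leq0n N) Nn) fd frho).
move=> /(_ (NP _ (leqnSn N)) (NP _ (ltnW Nn))) h.
rewrite -(ltr_pM2l (divr_gt0 pi0 (ltr0n _ 2))); apply: le_lt_trans h _.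
rewrite /x; have : 0 < e * pi by rewrite mulr_gt0.
by lra.
Unshelve. all: by end_near. Qed.

End CoefCvg.

(** * The uniform mean bound *)

(** Specialises to right endpoint [pi], allowed as [pi < 2 * pi], and passes from extended real to
    real integrals. *)
Lemma L1loc_boundary_Rintegral (R : realType) (U : R -> R -> R) :
  L1loc_boundary U -> exists f : R -> R,
    (forall a, 0 < a -> mu.-integrable `[a, pi] (EFin \o f)) /\
    (forall a, 0 < a ->
      \int[mu]_(t in `[a, pi]) `|U r t - f t| @[r --> 1^'-] --> 0).
Proof.
move=> [f [fi Uf]]; exists f.
have pi2 : pi < 2 * pi :> R by rewrite ltr_pMl ?pi_gt0// ltr1n.
by split=> a a0; [exact: fi|exact: fine_cvg (Uf a pi a0 pi2)].
Qed.

Lemma subset_itv_half (R : realType) (a : R) :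
  0 < a -> `[0, a[ `<=` `]- a, a[.
Proof.
move=> a0 t /=; rewrite !in_itv/= => /andP[t0 ->]; rewrite andbT.
by rewrite (lt_le_trans _ t0)// oppr_lt0.
Qed.

Lemma bounded_measurable_integrable_oo (R : realType) (w : R -> R) (a b : R) :
  bounded_measurable w -> mu.-integrable `]a, b[ (EFin \o w).
Proof.
move=> bw; have := bounded_measurable_integrable a b bw.
by apply: integrableS => // t /=; rewrite !in_itv/= => /andP[/ltW -> /ltW].
Qed.

Section MeanBound.
Context (R : realType) (c : nat -> R) (f : R -> R) (theta0 : R)
  (ac : analytic_on_disc c) (theta0pi : 0 < theta0 < pi)
  (fi : forall a : R, 0 < a -> mu.-integrable `[a, pi] (EFin \o f))
  (Uf : forall a : R, 0 < a ->
     \int[mu]_(t in `[a, pi]) `|ReF c r t - f t| @[r --> 1^'-] --> 0).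

Let inU (a b r : R) : 0 <= r < 1 ->
  mu.-integrable `[a, b] (EFin \o (fun t => `|ReF c r t|)).
Proof.
move=> r01; apply: integrable_norm.
exact/bounded_measurable_integrable/bounded_measurable_ReF.
Qed.

Let inf_ : mu.-integrable `[theta0, pi] (EFin \o (fun t => `|f t|)).
Proof. by apply: integrable_norm; apply: fi; case/andP: theta0pi. Qed.

(** Away from 0, convergence in mean makes the integral of [|U_r - f|] at most 1 for [r] near 1. *)
Let outer : \forall r \near 1^'-, \int[mu]_(t in `[theta0, pi]) `|ReF c r t| <=
  \int[mu]_(t in `[theta0, pi]) `|f t| + 1.
Proof.
have /andP[t0 tpi] := theta0pi.
have /cvgrPdist_le/(_ _ ltr01) U1 := Uf t0; near=> r.
have r01 : 0 <= r < 1 by near: r; exact: near01.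
have h : \int[mu]_(t in `[theta0, pi]) `|ReF c r t - f t| <= 1.
  by apply: le_trans (ler_norm _) _; rewrite -normrN -sub0r; near: r.
have iUf : mu.-integrable `[theta0, pi] (EFin \o (fun t => `|ReF c r t - f t|)).
  apply: integrable_norm; apply: integrable_subr => //; last exact: fi.
  exact/bounded_measurable_integrable/bounded_measurable_ReF.
have : \int[mu]_(t in `[theta0, pi]) `|ReF c r t| <=
    \int[mu]_(t in `[theta0, pi]) (`|f t| + `|ReF c r t - f t|).
  apply: le_Rintegral => //; [exact: inU|exact: integrable_addr|].
  by move=> t _; have := ler_normD (f t) (ReF c r t - f t); rewrite addrC subrK addrC.
by rewrite RintegralD//=; move: h; lra.
Unshelve. all: by end_near. Qed.

Lemma mean_bounded (M : R) :
  (\forall r \near 1^'-, \int[mu]_(t in `[0, theta0]) `|ReF c r t| <= M) ->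
  \forall r \near 1^'-, \int[mu]_(t in `[0, pi]) `|ReF c r t| <=
    M + (\int[mu]_(t in `[theta0, pi]) `|f t| + 1).
Proof.
have /andP[t0 tpi] := theta0pi; move=> UM; near=> r.
have r01 : 0 <= r < 1 by near: r; exact: near01.
rewrite (Rintegral_itv_split (ltW t0) (ltW tpi)); last exact: inU.
by apply: lerD; near: r.
Unshelve. all: by end_near. Qed.

(* [|U| - U] is twice the negative part of [U], hence at most [2|g|], while the
   mean of [U] over the whole circle is [c 0]. *)
Lemma lower_bound_mean_bounded (g : R -> R) :
  mu.-integrable `]- theta0, theta0[ (EFin \o g) ->
  {ae mu, forall t, t \in `]- theta0, theta0[ ->
    forall r, 0 <= r < 1 -> g t <= ReF c r t} ->
  exists M, \forall r \near 1^'-, \int[mu]_(t in `[0, theta0]) `|ReF c r t| <= M.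
Proof.
have /andP[t0 tpi] := theta0pi; move=> gi gU.
have sub := subset_itv_half t0.
have gi' : mu.-integrable `[0, theta0[ (EFin \o (fun t => 2 * `|g t|)).
  by apply: integrable_mulrl => //; apply: integrable_norm; exact: integrableS gi.
exists (\int[mu]_(t in `[0, theta0[) (2 * `|g t|) +
  (`|pi * c 0%N| + (\int[mu]_(t in `[theta0, pi]) `|f t| + 1))).
near=> r; have r01 : 0 <= r < 1 by near: r; exact: near01.
have bU := bounded_measurable_ReF ac r01.
have bD : bounded_measurable (fun t => `|ReF c r t| - ReF c r t).
  by apply: bounded_measurableB => //; exact: bounded_measurable_norm.
have iD : mu.-integrable `[0, theta0[ (EFin \o (fun t => `|ReF c r t| - ReF c r t)).
  have := bounded_measurable_integrable 0 theta0 bD; apply: integrableS => //.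
  by move=> t /=; rewrite !in_itv/= => /andP[-> /ltW].
have inner : \int[mu]_(t in `[0, theta0]) (`|ReF c r t| - ReF c r t) <=
    \int[mu]_(t in `[0, theta0[) (2 * `|g t|).
  (* Dropping the null endpoint [theta0] keeps the domain inside the open interval where [g] is a
     lower bound. *)
  rewrite -Rintegral_itv_bndo_bndc// /Rintegral fine_le//; try exact: integrable_fin_num.
  apply: ae_ge0_le_integral => //=.
  - by move=> t _; rewrite lee_fin subr_ge0 ler_norm.
  - exact: (measurable_int mu iD).
  - exact: (measurable_int mu gi').
  - case: gU => N [mN N0 subN]; exists N; split=> // t /= nle; apply: subN => /= h.
    apply: nle => /sub tt; rewrite lee_fin.
    have {h} := h tt r r01; have := ler_norm (- g t); rewrite normrN.
    (* Where [U >= 0] the left side is 0; elsewhere it is [- 2 * U], at most [- 2 * g]. *)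
    by case: (ger0P (ReF c r t)); have := normr_ge0 (g t); lra.
(* The total integral [pi * c 0] and the bound on the outer piece control the integral of [U_r] over
   [[0, theta0]] from above. *)
have h0 := ReF_coef0 ac r01.
rewrite (Rintegral_itv_split (ltW t0) (ltW tpi)) in h0;
  last exact: bounded_measurable_integrable.
have h1 : `|\int[mu]_(t in `[theta0, pi]) ReF c r t| <=
    \int[mu]_(t in `[theta0, pi]) `|ReF c r t|.
  by apply: le_normr_Rintegral => //; exact: bounded_measurable_integrable.
have h2 : \int[mu]_(t in `[theta0, pi]) `|ReF c r t| <=
  \int[mu]_(t in `[theta0, pi]) `|f t| + 1 by near: r.
rewrite RintegralB//= in inner; [|exact: inU|exact: bounded_measurable_integrable].
have h3 := ler_norm (pi * c 0%N).
move: h1; rewrite ler_norml => /andP[h1 _].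
by move: inner h0 h1 h2 h3; lra.
Unshelve. all: by end_near. Qed.

End MeanBound.

(** * Abel's theorem and the three alternatives *)

(** The weights [(1 - r) * r ^+ k] sum to 1, so the error is a weighted mean of the [c k - L]. As
    [r] tends to 1, the weight of any fixed initial segment vanishes. *)
Lemma Abel_limit (R : realType) (c : nat -> R) (L : R) :
  analytic_on_disc c -> c @ \oo --> L ->
  (fun r => (1 - r) * ReF c r 0) @ 1^'- --> L.
Proof.
move=> ac cL; apply/cvgrPdist_le => e e0.
have e20 : 0 < e / 2 by rewrite divr_gt0.
have /cvgrPdist_le/(_ _ e20)[N _ cN] := cL.
pose K := \sum_(0 <= k < N) `|c k - L|.
have K0 : 0 <= K by rewrite /K big_mkord sumr_ge0.
near=> r.
have r0 : 0 <= r by near: r; exact: nbhs_left_ge.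
have r1 : r < 1 by near: r; exact: nbhs_left_lt.
have r01 : 0 <= r < 1 by rewrite r0.
have rK : (1 - r) * K <= e / 2.
  have : 1 - e / 2 / (K + 1) < r.
    by near: r; apply: nbhs_left_gt; rewrite ltrBlDr ltrDl divr_gt0// ltr_wpDl.
  rewrite ltrBlDr -ltrBlDl ltr_pdivlMr ?ltr_wpDl//.
  by rewrite mulrDr mulr1; move: r1; lra.
(* The estimate is made on partial sums, whose weights add up to [1 - r ^+ P]. *)
have h : `|(1 - r) * cos_sum c r P 0 - L * (1 - r ^+ P)| @[P --> \oo] -->
    `|(1 - r) * ReF c r 0 - L * (1 - 0)|.
  apply: cvg_norm; apply: cvgB.
    by apply: cvgM; [exact: cvg_cst|exact: cvg_cos_sum].
  apply: cvgM; first exact: cvg_cst.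
  by apply: cvgB; [exact: cvg_cst|apply: cvg_expr; rewrite ger0_norm].
rewrite distrC -[X in _ - X]mulr1 -[X in L * X]subr0; apply: (cvgr_to_le h).
near=> P.
have NP : (N <= P)%N by near: P; exact: nbhs_infty_ge.
have geo : (1 - r) * \sum_(0 <= k < P) r ^+ k = 1 - r ^+ P.
  by rewrite -opprB mulNr big_mkord -subrX1 opprB.
have -> : (1 - r) * cos_sum c r P 0 - L * (1 - r ^+ P) =
    (1 - r) * \sum_(0 <= k < P) (c k - L) * r ^+ k.
  rewrite -geo mulrCA -mulrBr; congr (_ * _).
  rewrite /cos_sum /series/= mulr_sumr -sumrB; apply: eq_bigr => k _.
  by rewrite mulr0 cos0 mulr1 mulrBl.
have r10 : 0 <= 1 - r by rewrite subr_ge0 ltW.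
rewrite normrM (ger0_norm r10).
(* Before [N] the powers are bounded by 1 and the differences add up to at most [K]; from [N] on
   each difference is at most [e / 2]. *)
have S : `|\sum_(0 <= k < P) (c k - L) * r ^+ k| <=
    K + e / 2 * \sum_(0 <= k < P) r ^+ k.
  apply: le_trans (ler_norm_sum _ _ _) _.
  rewrite (big_cat_nat (n := N))//= [X in _ <= _ + _ * X](big_cat_nat (n := N))//=.
  rewrite mulrDr addrA lerD//.
    rewrite ler_wpDr//.
      by rewrite mulr_ge0 ?(ltW e20)// big_nat sumr_ge0// => k _; rewrite exprn_ge0.
    apply: ler_sum => k _; rewrite normrM -[leRHS]mulr1 ler_wpM2l//.
    by rewrite ger0_norm ?exprn_ge0// exprn_ile1// ltW.
  rewrite mulr_sumr; apply: ler_sum_nat => k /andP[Nk _].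
  rewrite normrM (ger0_norm (exprn_ge0 _ r0)) ler_wpM2r ?exprn_ge0//.
  by rewrite distrC; exact: cN.
apply: le_trans (ler_wpM2l r10 S) _.
rewrite mulrDr mulrCA geo.
have : e / 2 * (1 - r ^+ P) <= e / 2 * 1.
  by rewrite ler_wpM2l ?(ltW e20)// gerBl exprn_ge0.
by move: rK; lra.
Unshelve. all: by end_near. Qed.

Set Strict Implicit.
Unset Implicit Arguments.

Theorem theorem1p4 (R : realType) (c : nat -> R) (theta0 : R) :
  analytic_on_disc c ->
  L1loc_boundary (ReF c) ->
  0 < theta0 < pi ->
  ((exists C : R, 0 <= C /\
      forall theta r : R, - theta0 < theta < theta0 -> 0 <= r < 1 ->
        - C <= ReF c r theta)
   \/
   (exists M : R, forall r : R, 0 < r < 1 ->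
      (\int[lebesgue_measure]_(t in `](- theta0)%R, theta0[) `|ReF c r t|%:E
         <= M%:E)%E)
   \/
   (exists (g : R -> R) (k : nat) (K : R),
      (lebesgue_measure).-integrable `]- theta0, theta0[ (EFin \o g) /\
      (forall theta r : R, - theta0 < theta < theta0 -> 0 <= r < 1 ->
         `|ReF c r theta| <= K * (1 - r) ^- k) /\
      {ae lebesgue_measure, forall theta : R,
         theta \in `]- theta0, theta0[ ->
         forall r : R, 0 <= r < 1 -> g theta <= ReF c r theta})) ->
  exists L : R,
    c @ \oo --> L /\ (fun r => (1 - r) * ReF c r 0) @ 1^'- --> L.
Proof.
move=> ac /L1loc_boundary_Rintegral[f [fi Uf]] t0pi hyp.
have [M UM] : exists M, \forall r \near 1^'-,
    \int[mu]_(t in `[0, theta0]) `|ReF c r t| <= M.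
  case: hyp => [[C [_ UC]]|[[M UM]|[g [k [K [gi [_ gU]]]]]]].
  (* A constant lower bound is an integrable one on a bounded interval. *)
  - apply: (lower_bound_mean_bounded ac t0pi fi Uf (g := fun=> - C)).
      exact/bounded_measurable_integrable_oo/bounded_measurable_cst.
    by apply: aeW => t; rewrite in_itv/= => tt r; exact: UC.
  - exists M; have /andP[t0 tpi] := t0pi; near=> r.
    have r0 : 0 < r by near: r; exact: nbhs_left_gt.
    have r1 : r < 1 by near: r; exact: nbhs_left_lt.
    have bU : bounded_measurable (fun t => `|ReF c r t|).
      by apply/bounded_measurable_norm/bounded_measurable_ReF => //; rewrite (ltW r0).
    have iU : mu.-integrable `]- theta0, theta0[ (EFin \o (fun t => `|ReF c r t|)).
      exact: bounded_measurable_integrable_oo.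
    have sub := subset_itv_half t0.
    have iU' : mu.-integrable `[0, theta0[ (EFin \o (fun t => `|ReF c r t|)).
      exact: integrableS iU.
    rewrite -Rintegral_itv_bndo_bndc// -lee_fin /Rintegral fineK;
      last exact: integrable_fin_num.
    (* The integrand is nonnegative, so restricting to [[0, theta0[] only decreases the integral. *)
    apply: le_trans (UM r _); last by rewrite r0.
    apply: ge0_subset_integral => //; exact: (measurable_int mu iU).
  - exact: (lower_bound_mean_bounded ac t0pi fi Uf gi gU).
have /cvg_ex[L cL] := coef_cvg ac fi Uf (mean_bounded ac t0pi fi Uf UM).
by exists L; split=> //; exact: Abel_limit.
Unshelve. all: by end_near. Qed.
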